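(* In ZFC, $\mathfrak{adp}_2=\mathfrak{ap}$.
   Context: $[\omega]^{\aleph_0}$ is the set of infinite subsets of $\omega$. For $a,b\subseteq\omega$, $a\perp b$ means that $a\cap b$ is finite. For $\mathcal A,\mathcal B\subseteq[\omega]^{\aleph_0}$, $\mathcal A\perp\mathcal B$ means $a\perp b$ for all $a\in\mathcal A$, $b\in\mathcal B$. $\mathcal A$ is weakly separated from $\mathcal B$ if there is $X\subseteq\omega$ such that $a\cap X$ is infinite for every $a\in\mathcal A$ and $b\cap X$ is finite for every $b\in\mathcal B$ (this notion is not symmetric). $\mathcal A\subseteq[\omega]^{\aleph_0}$ is an almost disjoint family if $a\perp b$ for every two distinct $a,b\in\mathcal A$. $\mathfrak{ap}$ is the least cardinal $\kappa$ for which there exist $\mathcal A,\mathcal B\subseteq[\omega]^{\aleph_0}$ such that $\mathcal A\perp\mathcal B$, $|\mathcal A\cup\mathcal B|=\kappa$, $\mathcal A\cup\mathcal B$ is an almost disjoint family, and $\mathcal A$ is not weakly separated from $\mathcal B$. $\mathfrak{adp}_2$ is the least cardinal $\kappa$ for which there exist $\mathcal A,\mathcal B\subseteq[\omega]^{\aleph_0}$ such that $\mathcal A\perp\mathcal B$, $|\mathcal A\cup\mathcal B|=\kappa$, $\mathcal B$ is an almost disjoint family, and $\mathcal A$ is not weakly separated from $\mathcal B$. *)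

(* Defs.v *)
From mathcomp Require Import all_boot.
From mathcomp Require Import boolp classical_sets functions cardinality.

Set Implicit Arguments.
Unset Strict Implicit.
Unset Printing Implicit Defensive.

Local Open Scope classical_set_scope.
Local Open Scope card_scope.

(* [orth a b] is a _|_ b for subsets of omega. *)
Definition orth (a b : set nat) : Prop := finite_set (a `&` b).

Definition orth_fam (A B : set (set nat)) : Prop :=
  forall a b, A a -> B b -> orth a b.

Definition infinite_subsets : set (set nat) := [set a | infinite_set a].

Definition almost_disjoint (A : set (set nat)) : Prop :=
  forall a b, A a -> A b -> a <> b -> orth a b.

Definition weakly_separated_from (A B : set (set nat)) : Prop :=
  exists X : set nat,
    (forall a, A a -> infinite_set (a `&` X)) /\
    (forall b, B b -> finite_set (b `&` X)).

(* Cardinal numbers are equipotence classes, taken among the subsets of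
   P(omega): every family considered here is such a subset, so no cardinality
   is lost.  Two families have the same cardinality iff their classes are
   equal (Leibniz equality). *)
Definition cardinal := set (set (set nat)).

Definition cardinality (F : set (set nat)) : cardinal := [set G | G #= F].

Definition cardinal_le (k l : cardinal) : Prop :=
  exists F G, [/\ k = cardinality F, l = cardinality G & F #<= G].

Definition is_least_cardinal (P : cardinal -> Prop) (k : cardinal) : Prop :=
  P k /\ forall l, P l -> cardinal_le k l.

(* The default value [set0] (not an equipotence class) is taken only when
   there is no least cardinal satisfying [P]; [apP] and [adp2P] below show
   that this does not happen for the two cardinals defined here. *)
Definition least_cardinal (P : cardinal -> Prop) : cardinal :=
  xget set0 [set k | is_least_cardinal P k].

Definition ap_witnessed (k : cardinal) : Prop :=
  exists A B : set (set nat),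
    [/\ A `<=` infinite_subsets /\ B `<=` infinite_subsets,
        orth_fam A B,
        cardinality (A `|` B) = k,
        almost_disjoint (A `|` B) &
        ~ weakly_separated_from A B].

Definition adp2_witnessed (k : cardinal) : Prop :=
  exists A B : set (set nat),
    [/\ A `<=` infinite_subsets /\ B `<=` infinite_subsets,
        orth_fam A B,
        cardinality (A `|` B) = k,
        almost_disjoint B &
        ~ weakly_separated_from A B].

Definition ap : cardinal := least_cardinal ap_witnessed.

Definition adp2 : cardinal := least_cardinal adp2_witnessed.

Lemma cardinality_eqP (F G : set (set nat)) :
  cardinality F = cardinality G <-> F #= G.
Proof.
split=> [e|FG].
  have : cardinality F F by exact: card_eqxx.
  by rewrite e.
apply/seteqP; split=> H /= HF.
  exact: card_eq_trans HF FG.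
by apply: card_eq_trans HF _; rewrite card_eq_sym.
Qed.

Lemma cardinal_leE (F G : set (set nat)) :
  cardinal_le (cardinality F) (cardinality G) <-> F #<= G.
Proof.
split=> [[F' [G' [/cardinality_eqP FF' /cardinality_eqP GG' FG]]]|FG];
  last by exists F, G.
by rewrite (card_le_eql FF') (card_le_eqr GG').
Qed.

(* Zorn's lemma applied to the sets of choice functions on [S] that pairwise
   differ everywhere on [S]: in a maximal such set some evaluation map is
   onto. *)
Lemma exists_least_card (T : Type) (S : set (set T)) : S !=set0 ->
  exists2 A, S A & forall B, S B -> A #<= B.
Proof.
move=> [A0 SA0].
have [[a0 A0a0]|/set0P/negP/negPn/eqP A0e] := pselect (A0 !=set0); last first.
  by exists A0 => // B _; rewrite A0e card_ge0.
pose P (F : set (set T -> T)) :=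
  (forall f, F f -> forall A, S A -> A (f A)) /\
  (forall f g A, F f -> F g -> S A -> f A = g A -> f = g).
have [|F [[F1 F2] Fmax]] := @Zorn_bigcup _ P.
  move=> C CP Ctot; split; first by move=> f [X CX Xf]; exact: (CP _ CX).1.
  move=> f g A [X CX Xf] [Y CY Yg] SA fgA.
  have [XY|YX] := Ctot _ _ CX CY.
    by apply: ((CP _ CY).2 f g A) => //; exact: XY.
  by apply: ((CP _ CX).2 f g A) => //; exact: YX.
suff [A SA FA] : exists2 A, S A & A `<=` (fun f => f A) @` F.
  exists A => // B SB; apply: (card_le_trans (subset_card_le FA)).
  apply: (card_le_trans (card_image_le _ _)).
  have FB : {in F &, injective (fun f : set T -> T => f B)}.
    by move=> f g /set_mem Ff /set_mem Fg; exact: F2.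
  rewrite -(card_le_eql (inj_card_eq FB)).
  by apply: subset_card_le => _ [f Ff <-]; exact: (F1 f Ff B SB).
apply: contrapT => noA.
have {noA} ch A : exists a, S A -> A a /\ forall f, F f -> f A <> a.
  have [SA|nSA] := pselect (S A); last by exists a0.
  apply: contrapT => noa; apply: noA; exists A => // a Aa.
  apply: contrapT => na; apply: noa; exists a => _; split=> // f Ff fAa.
  by apply: na; exists f.
have [f fP] := choice ch.
apply: (Fmax (F `|` [set f])).
  split; first by move=> g Fg; left.
  move=> /(_ f (or_intror erefl)) Ff.
  exact: (fP _ SA0).2 f Ff erefl.
split=> [g [Fg|->] A SA|g h A [Fg|->] [Fh|->] SA] //.
- exact: (F1 g Fg A SA).
- exact: (fP _ SA).1.
- exact: F2.
- by move=> /((fP _ SA).2 _ Fg).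
- by move=> /esym/((fP _ SA).2 _ Fh).
Qed.

Lemma least_cardinalP (P : cardinal -> Prop) :
  (forall k, P k -> exists F, k = cardinality F) -> (exists k, P k) ->
  is_least_cardinal P (least_cardinal P).
Proof.
move=> Pc [k Pk]; have [F kF] := Pc _ Pk.
have [|A PA Amin] := @exists_least_card _ [set F | P (cardinality F)].
  by exists F; rewrite /= -kF.
suff L : exists k, is_least_cardinal P k.
  exact: (@xgetPex _ set0 [set k | is_least_cardinal P k] L).
exists (cardinality A); split=> // l Pl.
have [G lG] := Pc _ Pl.
by rewrite lG; apply/cardinal_leE/Amin; rewrite /= -lG.
Qed.

Lemma least_cardinal_unique (P : cardinal -> Prop) (k : cardinal) :
  is_least_cardinal P k -> least_cardinal P = k.
Proof.
move=> Lk; apply: xget_unique => // l [Pl lmin].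
have [F [G [lF kG FG]]] := lmin _ Lk.1.
have := Lk.2 _ Pl; rewrite lF kG => /cardinal_leE GF.
by apply/cardinality_eqP; rewrite card_eq_le FG GF.
Qed.

(* Initial segments of [X], coded as naturals: an almost disjoint family of
   infinite sets indexed by P(omega). *)
Definition branch (X : set nat) : set nat :=
  range (fun n => pickle (mkseq (fun i => `[< X i >]) n)).

Lemma branch_infinite (X : set nat) : infinite_set (branch X).
Proof.
rewrite /branch => fX; apply: infinite_nat; move: fX.
rewrite (eq_finite_set (inj_card_eq _)) // => m n _ _ /(pcan_inj pickleK).
by move=> /(congr1 size); rewrite !size_mkseq.
Qed.

Lemma branch_orth (X Y : set nat) : X <> Y -> orth (branch X) (branch Y).
Proof.
move=> XY.
have [i XYi] : exists i, `[< X i >] != `[< Y i >].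
  apply: contrapT => noi; apply: XY; apply/funext => i; apply/propext.
  by apply: asbool_eq_equiv; apply: contrapT => /eqP ni; apply: noi; exists i.
apply: (@sub_finite_set _ _
  ((fun n => pickle (mkseq (fun i => `[< X i >]) n)) @` `I_i.+1)).
  move=> _ [[n _ <-] [m _ /(pcan_inj pickleK) e]]; exists n => //=.
  rewrite ltnS leqNgt; apply/negP => ilen; move/eqP: XYi; apply.
  have mn : m = n by move/(congr1 size): e; rewrite !size_mkseq.
  move/(congr1 (fun s => nth false s i)): e.
  by rewrite !nth_mkseq // mn.
exact/finite_image/finite_II.
Qed.

Lemma ap_adp2_witnessed (k : cardinal) : ap_witnessed k -> adp2_witnessed k.
Proof.
move=> [A [B [AB oAB ck ad nws]]]; exists A, B; split=> //.
by move=> a b Ba Bb; apply: ad; right.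
Qed.

(* Diagonalisation: no [X] separates the branches according to whether
   [branch X] meets [X] in a finite or in an infinite set. *)
Lemma ap_witnessed_ex : exists k, ap_witnessed k.
Proof.
pose A := [set branch X | X in [set X | finite_set (branch X `&` X)]].
pose B := [set branch X | X in [set X | infinite_set (branch X `&` X)]].
exists (cardinality (A `|` B)), A, B; split=> //.
- by split=> _ [X _ <-]; exact: branch_infinite.
- move=> _ _ [X fX <-] [Y iY <-]; apply: branch_orth => XY.
  by apply: iY; rewrite -XY.
- move=> a b ABa ABb ab.
  have br c : (A `|` B) c -> exists X, c = branch X.
    by move=> [] [X _ <-]; exists X.
  have [X aX] := br _ ABa; have [Y bY] := br _ ABb.
  by rewrite aX bY; apply: branch_orth => XY; apply: ab; rewrite aX bY XY.
- move=> [X [AX BX]].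
  have [fX|iX] := pselect (finite_set (branch X `&` X)).
    by have /AX : A (branch X) by exists X.
  by have /BX : B (branch X) by exists X.
Qed.

Lemma apP : is_least_cardinal ap_witnessed ap.
Proof.
apply: least_cardinalP ap_witnessed_ex => k [A [B [_ _ <- _ _]]].
by exists (A `|` B).
Qed.

Lemma adp2P : is_least_cardinal adp2_witnessed adp2.
Proof.
apply: least_cardinalP => [k [A [B [_ _ <- _ _]]]|]; first by exists (A `|` B).
by have [k /ap_adp2_witnessed] := ap_witnessed_ex; exists k.
Qed.

(* Main.v *)
From mathcomp Require Import all_boot.
From mathcomp Require Import boolp classical_sets functions cardinality.
Require Import Defs.

(** The two cardinals agree because they have exactly the same witnesses in
    every cardinality.  One direction is immediate.  For the other, let
    [A], [B] witness adp_2, and replace the points of omega by the finite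
    binary strings, a natural [n] being spread out into the finite level of
    strings of length [n].  The levels being finite, [B] can be moved upstairs
    by replacing each [b] by the set [levels b] of all strings whose length is
    in [b]: orthogonality is preserved.  An [a] in [A], on the contrary, is
    replaced by the infinite set [thread a] of those initial segments of its
    own characteristic function whose length is in [a].  Different threads lie
    on different branches of the binary tree, so the threads are almost
    disjoint, although nothing was assumed of [A]; and since [thread a] is part
    of [levels a], it is still orthogonal to each [levels b].

    Taking the set of lengths ([lengths]) recovers [a] from [thread a] and [b]
    from [levels b], whence the cardinality is unchanged; and the lengths of a
    set weakly separating the threads from the levels weakly separate [A] from
    [B].  Strings are coded by naturals through [pickle]. *)

Set Implicit Arguments.
Unset Strict Implicit.
Unset Printing Implicit Defensive.

Local Open Scope classical_set_scope.
Local Open Scope card_scope.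

Definition levels (c : set nat) : set nat :=
  [set pickle s | s in [set s : seq bool | c (size s)]].

Definition thread (c : set nat) : set nat :=
  [set pickle (mkseq (fun i => `[< c i >]) n) | n in c].

Definition lengths (Y : set nat) : set nat :=
  [set size s | s in [set s : seq bool | Y (pickle s)]].

Lemma levelsE (c : set nat) (s : seq bool) : levels c (pickle s) <-> c (size s).
Proof.
by split=> [[t ct /(pcan_inj pickleK) <-]|cs] //; exists s.
Qed.

Lemma lengths_levels : cancel levels lengths.
Proof.
move=> c; apply/seteqP; split=> [_ [s /levelsE cs <-]|n cn] //.
by exists (nseq n true); [apply/levelsE|]; rewrite size_nseq.
Qed.

Lemma lengths_thread : cancel thread lengths.
Proof.
move=> c; apply/seteqP; split=> [_ [s [n cn /(pcan_inj pickleK) <-] <-]|n cn].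
  by rewrite size_mkseq.
by exists (mkseq (fun i => `[< c i >]) n); [exists n|rewrite size_mkseq].
Qed.

Lemma sub_thread_levels (c : set nat) : thread c `<=` levels c.
Proof. by move=> _ [n cn <-]; apply/levelsE; rewrite size_mkseq. Qed.

Lemma sub_thread_branch (c : set nat) : thread c `<=` branch c.
Proof. by move=> _ [n _ <-]; exists n. Qed.

Lemma levels_setI (b c : set nat) :
  levels b `&` levels c = levels (b `&` c).
Proof.
apply/seteqP; split=> [_ [[s bs <-] /levelsE cs]|_ [s [bs cs] <-]].
  by exists s.
by split; apply/levelsE.
Qed.

Lemma finite_levels (c : set nat) : finite_set c -> finite_set (levels c).
Proof.
move=> fc.
apply: (@sub_finite_set _ _
  (\bigcup_(n in c) [set pickle (val t) | t in [set: n.-tuple bool]])).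
  by move=> _ [s cs <-]; exists (size s) => //; exists (in_tuple s).
by apply: bigcup_finite => // n _; apply: finite_image.
Qed.

Lemma finite_lengths (Y : set nat) : finite_set Y -> finite_set (lengths Y).
Proof.
move=> fY.
apply: (@sub_finite_set _ _
  ((fun m => if unpickle m is Some s then size (s : seq bool) else 0) @` Y)).
  by move=> _ [s Ys <-]; exists (pickle s) => //; rewrite pickleK.
exact: finite_image.
Qed.

Lemma levels_infinite (c : set nat) : infinite_set c -> infinite_set (levels c).
Proof. by move=> ic /finite_lengths; rewrite lengths_levels. Qed.

Lemma thread_infinite (c : set nat) : infinite_set c -> infinite_set (thread c).
Proof. by move=> ic /finite_lengths; rewrite lengths_thread. Qed.

Lemma levels_orth (b c : set nat) : orth b c -> orth (levels b) (levels c).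
Proof. by rewrite /orth levels_setI; exact: finite_levels. Qed.

Lemma thread_levels_orth (a b : set nat) :
  orth a b -> orth (thread a) (levels b).
Proof.
move=> /levels_orth; apply: sub_finite_set => m [+ bm].
by move=> /sub_thread_levels.
Qed.

Lemma thread_orth (a b : set nat) : a <> b -> orth (thread a) (thread b).
Proof.
by move=> /branch_orth; apply: sub_finite_set; apply: setISS;
  exact: sub_thread_branch.
Qed.

Lemma orth_sym (a b : set nat) : orth a b -> orth b a.
Proof. by rewrite /orth setIC. Qed.

Lemma almost_disjoint_thread_levels (A B : set (set nat)) :
  orth_fam A B -> almost_disjoint B ->
  almost_disjoint (thread @` A `|` levels @` B).
Proof.
move=> AB adB _ _ [[a Aa <-]|[a Ba <-]] [[b Ab <-]|[b Bb <-]] ne.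
- by apply: thread_orth => ab; apply: ne; rewrite ab.
- exact/thread_levels_orth/AB.
- exact/orth_sym/thread_levels_orth/AB.
- by apply/levels_orth/adB => // ab; apply: ne; rewrite ab.
Qed.

(** Disjointness of [A] and [B] allows [thread] on [A] and [levels] on [B] to be
    glued into a single map, of which [lengths] is a left inverse. *)
Lemma card_thread_levels (A B : set (set nat)) : A `&` B = set0 ->
  thread @` A `|` levels @` B #= A `|` B.
Proof.
move=> AB0; pose F c := if `[< A c >] then thread c else levels c.
have FK : cancel F lengths.
  by rewrite /F => c; case: ifP; rewrite ?lengths_thread ?lengths_levels.
have FA a : A a -> F a = thread a by rewrite /F => /asboolP ->.
have FB b : B b -> F b = levels b.
  move=> Bb; rewrite /F asboolF // => Ab.
  by have : (A `&` B) b by []; rewrite AB0.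
rewrite -(eq_imagel FA) -(eq_imagel FB) -image_setU.
by apply: inj_card_eq => c d _ _; exact: can_inj FK c d.
Qed.

(** If [lengths Y] met [a] in a finite set, then [Y] would meet [thread a]
    inside finitely many levels, each of which is finite.  On the side of [B]
    the whole levels matter: a length in [b] of some string coded in [Y] is the
    length of a point of [levels b] in [Y], whichever string that is. *)
Lemma weakly_separated_lengths (A B : set (set nat)) :
  weakly_separated_from (thread @` A) (levels @` B) ->
  weakly_separated_from A B.
Proof.
move=> [Y [AY BY]]; exists (lengths Y); split=> [a Aa|b Bb].
  move=> /finite_levels fa; apply: (AY (thread a)); first by exists a.
  apply: sub_finite_set fa => _ [/sub_thread_levels[s sa <-] Ys].
  by apply/levelsE; split=> //; exists s.
have /finite_lengths : finite_set (levels b `&` Y) by apply: BY; exists b.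
apply: sub_finite_set => n [bn [s Ys sn]].
by rewrite -sn in bn *; exists s => //; split=> //; apply/levelsE.
Qed.

Lemma adp2_ap_witnessed (k : cardinal) : adp2_witnessed k -> ap_witnessed k.
Proof.
move=> [A [B [[iA iB] AB <- adB nws]]].
exists (thread @` A), (levels @` B); split.
- split=> _ [c ? <-]; first exact/thread_infinite/iA.
  exact/levels_infinite/iB.
- by move=> _ _ [a Aa <-] [b Bb <-]; exact/thread_levels_orth/AB.
- apply/cardinality_eqP/card_thread_levels.
  (* A common element would be an infinite set orthogonal to itself. *)
  apply/seteqP; split=> // c [Ac Bc]; apply: (iA _ Ac).
  by rewrite -(setIid c); exact: AB.
- exact: almost_disjoint_thread_levels.
- by move=> /weakly_separated_lengths.
Qed.

Theorem theorem7 : adp2 = ap.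
Proof.
rewrite /adp2 /ap; congr least_cardinal; apply/funext => k; apply/propext.
by split; [exact: adp2_ap_witnessed|exact: ap_adp2_witnessed].
Qed.
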